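(* Among the irreducible crystallographic Coxeter arrangements of rank four, i.e. $\mathcal{A}(A_4)$, $\mathcal{A}(B_4)$, $\mathcal{A}(D_4)$ and $\mathcal{A}(F_4)$, regarded as arrangements of projective planes in $\mathbb{P}^3(\mathbb{R})$, the arrangements $\mathcal{A}(A_4)$ and $\mathcal{A}(B_4)$ admit a special vertex, whereas the arrangements $\mathcal{A}(D_4)$ and $\mathcal{A}(F_4)$ do not. Moreover, the deletion chain $$\mathcal{A}^3_1(13)\subset\mathcal{A}^3_1(14)\subset\mathcal{A}^3_1(15)\subset\mathcal{A}^3_1(16)=\mathcal{A}(B_4)$$ consists entirely of irreducible simplicial arrangements admitting a special vertex.
   Context: An arrangement $\mathcal{A}$ in $\mathbb{P}^3(\mathbb{R})=\mathbb{P}(V)$, $V$ a 4-dimensional real vector space, is a finite set of distinct projective planes $H=\mathbb{P}(\ker a_H)$, $a_H\in V^*\setminus\{0\}$. It is essential if the covectors $a_H$ span $V^*$. It is reducible if, after a linear change of coordinates, its central cone (the corresponding central hyperplane arrangement in $V$) decomposes as a product of two nonempty lower-rank arrangements; otherwise it is irreducible. A chamber is a connected component of the complement of $\bigcup_{H\in\mathcal{A}}H$. An essential arrangement is simplicial if the closure of every chamber is combinatorially a tetrahedron; equivalently, every chamber has exactly four facets. Special vertex: for an essential arrangement $\mathcal{A}$ in $\mathbb{P}^3(\mathbb{R})$, a pair $(H_\infty,P)$ with $H_\infty\in\mathcal{A}$ and $P\notin H_\infty$ a point of $\mathbb{P}^3(\mathbb{R})$ is a special-vertex pair if for every $H\in\mathcal{A}\setminus\{H_\infty\}$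 there exists $H_P\in\mathcal{A}$ containing $P$ such that $H\cap H_\infty=H_P\cap H_\infty$. The arrangement admits a special vertex if it has a special-vertex pair. Coxeter arrangements (projectivizations of the rank-four reflection arrangements, up to linear change of coordinates), in homogeneous coordinates $[t:x:y:z]$: - $\mathcal{A}(A_4)$ (10 planes) is defined by $txyz(x-t)(y-t)(z-t)(x-y)(x-z)(y-z)=0$. - $\mathcal{A}(B_4)$ (16 planes) consists of the four coordinate planes $t=0$, $x=0$, $y=0$, $z=0$ and the twelve planes $u\pm v=0$ for $u,v$ two distinct coordinates among $t,x,y,z$. - $\mathcal{A}(D_4)$ (12 planes) consists of the twelve planes $u\pm v=0$ for $u,v$ two distinct coordinates among $t,x,y,z$. - $\mathcal{A}(F_4)$ (24 planes) consists of the 16 planes of $\mathcal{A}(B_4)$ together with the 8 planes $\varepsilon_1t+\varepsilon_2x+\varepsilon_3y+\varepsilon_4z=0$, $\varepsilon_i\in\{\pm1\}$ (opposite sign vectors giving the same plane). Deletion chain: $\mathcal{A}^3_1(16)=\mathcal{A}(B_4)$, $\mathcal{A}^3_1(15)=\mathcal{A}(B_4)\setminus\{t=0\}$, $\mathcal{A}^3_1(14)=\mathcal{A}(B_4)\setminus\{t=0,\ x=0\}$, $\mathcal{A}^3_1(13)=\mathcal{A}(B_4)\setminus\{t=0,\ x=0,\ y=0\}$ (each plane denoted by its equation). *)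

(* Defs.v *)
From HB Require Import structures.
From mathcomp Require Import all_boot all_order all_algebra finmap.
From mathcomp Require Import all_classical all_reals all_analysis.

Set Implicit Arguments.
Unset Strict Implicit.
Unset Printing Implicit Defensive.

Import Order.TTheory GRing.Theory Num.Theory.
Import numFieldNormedType.Exports.

Local Open Scope classical_set_scope.
Local Open Scope ring_scope.

Definition covector (R : fieldType) (W : vectType R) := 'Hom(W, R^o).

(* Central hyperplane arrangements in a finite-dimensional space W, given by
   their hyperplanes as subspaces of W. *)
Section CentralArrangements.
Context (R : fieldType).
Implicit Type W : vectType R.

Definition is_hyperplane W (H : {vspace W}) : Prop :=
  exists2 a : covector W, a != 0 & H = lker a.

Definition central_arrangement W (A : {fset {vspace W}}) : Prop :=
  forall H, H \in A -> is_hyperplane H.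

Definition arr_rank W (A : {fset {vspace W}}) : nat :=
  (\dim {:W} - \dim (\bigcap_(H <- A) H)%VS)%N.

(* H1 x W2 for H1 in A1, together with W1 x H2 for H2 in A2 *)
Definition product_arrangement W1 W2
    (A1 : {fset {vspace W1}}) (A2 : {fset {vspace W2}}) :
    {fset {vspace (W1 * W2)%type}} :=
  ([fset (linfun (@fst W1 W2) @^-1: H)%VS | H in A1] `|`
   [fset (linfun (@snd W1 W2) @^-1: H)%VS | H in A2])%fset.

(* The covector a H is determined by H up to a nonzero scalar, so the choice
   of a is irrelevant. *)
Definition essential W (A : {fset {vspace W}}) : Prop :=
  exists a : {vspace W} -> covector W,
    (forall H, H \in A -> a H != 0 /\ lker (a H) = H) /\
    <<[seq a H | H <- A]>>%VS = fullv.

Definition reducible W (A : {fset {vspace W}}) : Prop :=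
  exists (p q : nat) (A1 : {fset {vspace 'rV[R]_p}})
         (A2 : {fset {vspace 'rV[R]_q}})
         (g : 'Hom(W, ('rV[R]_p * 'rV[R]_q)%type)),
    [/\ bijective g,
        central_arrangement A1 /\ central_arrangement A2,
        A1 != fset0 /\ A2 != fset0,
        (arr_rank A1 < arr_rank A)%N /\ (arr_rank A2 < arr_rank A)%N &
        [fset (g @: H)%VS | H in A]%fset = product_arrangement A1 A2].

Definition irreducible W (A : {fset {vspace W}}) : Prop := ~ reducible A.

End CentralArrangements.

(* The points of P(R^4) are the lines through the origin of R^4. *)
Record P3 (R : realType) := Point {
  point_line : {vspace 'rV[R]_4};
  point_line_dim : \dim point_line == 1%N
}.

HB.instance Definition _ (R : realType) := [isSub of P3 R for @point_line R].
HB.instance Definition _ (R : realType) := [Choice of P3 R by <:].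

Section ProjectiveTopology.
Context (R : realType).
Implicit Type U : set (P3 R).

(* Preimage of U under the projection R^4 \ {0} -> P3; P3 carries the quotient
   topology.  As R^4 \ {0} is open, it does not matter whether openness is
   tested in R^4 \ {0} or in R^4. *)
Definition cone_over U : set 'rV[R]_4 :=
  [set v | exists2 p, U p & point_line p = <[v]>%VS].

Definition P3_open : set_system (P3 R) := [set U | open (cone_over U)].

Lemma cone_overT : cone_over setT = ~` [set 0].
Proof.
apply/seteqP; split=> v /=.
  case=> p _ pv v0; have := point_line_dim p.
  by rewrite pv v0 dim_vline eqxx.
move=> v0; have dv : \dim <[v]>%VS == 1%N.
  by rewrite dim_vline; move/eqP: v0 => ->.
by exists (Point dv).
Qed.

Lemma P3_openT : P3_open setT.
Proof.
rewrite /P3_open /= cone_overT; apply: closed_openC.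
exact: (accessible_closed_set1 (hausdorff_accessible (@norm_hausdorff _ _))).
Qed.

Lemma P3_openI : setI_closed P3_open.
Proof.
move=> U U' oU oU'; rewrite /P3_open /=.
have -> : cone_over (U `&` U') = cone_over U `&` cone_over U'; last exact: openI.
apply/seteqP; split=> v /=; first by case=> p [Up U'p] pv; split; exists p.
case=> -[p Up pv] [p' U'p' p'v]; exists p => //; split=> //.
by rewrite (_ : p = p') //; apply: val_inj; rewrite /= pv p'v.
Qed.

Lemma P3_open_bigU (I : Type) (f : I -> set (P3 R)) :
  (forall i, P3_open (f i)) -> P3_open (\bigcup_i f i).
Proof.
move=> of_; rewrite /P3_open /=.
have -> : cone_over (\bigcup_i f i) = \bigcup_i cone_over (f i).
  apply/seteqP; split=> v /=; first by case=> p [i _ fp] pv; exists i => //; exists p.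
  by case=> i _ [p fp pv]; exists p => //; exists i.
by apply: bigcup_open => i _; exact: of_.
Qed.

HB.instance Definition _ :=
  isOpenTopological.Build (P3 R) P3_openT P3_openI P3_open_bigU.

End ProjectiveTopology.

(* A projective arrangement is represented by its central cone: the subspace H
   of R^4 stands for the projective plane P(H). *)
Section ProjectiveArrangements.
Context (R : realType).
Local Notation V := 'rV[R]_4.
Implicit Type A : {fset {vspace V}}.

Definition proj_points (H : {vspace V}) : set (P3 R) :=
  [set p | (point_line p <= H)%VS].

Definition arrangement_complement A : set (P3 R) :=
  ~` \bigcup_(H in [set` A]) proj_points H.

Definition chamber A (C : set (P3 R)) : Prop :=
  exists2 p, arrangement_complement A p &
    C = connected_component (arrangement_complement A) p.

(* Faces of the closed polytope [closure C]: the polytope itself and its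
   intersections with the planes missing the open polytope C.  Such a plane is
   a supporting plane, or is disjoint from the polytope and cuts out the empty
   face. *)
Definition face (C F : set (P3 R)) : Prop :=
  F = closure C \/
  exists a : covector V,
    [/\ a != 0, proj_points (lker a) `&` C = set0 &
        F = closure C `&` proj_points (lker a)].

(* The face lattice is that of the simplex with vertex set 'I_4. *)
Definition tetrahedron (C : set (P3 R)) : Prop :=
  exists phi : {set 'I_4} -> set (P3 R),
    range phi = face C /\
    forall S T : {set 'I_4}, phi S `<=` phi T <-> S \subset T.

Definition simplicial A : Prop :=
  essential A /\ forall C, chamber A C -> tetrahedron C.

Definition special_vertex_pair A (Hinf : {vspace V}) (P : P3 R) : Prop :=
  [/\ Hinf \in A, ~ proj_points Hinf P &
      forall H, H \in A -> H != Hinf ->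
        exists HP, [/\ HP \in A, proj_points HP P &
          proj_points H `&` proj_points Hinf =
          proj_points HP `&` proj_points Hinf]].

Definition admits_special_vertex A : Prop :=
  exists Hinf P, special_vertex_pair A Hinf P.

End ProjectiveArrangements.

Section CoxeterArrangements.
Context (R : realType).
Local Notation V := 'rV[R]_4.

Definition entry (i : 'I_4) (v : V) : R^o := v 0 i.

Lemma entry_is_linear i : linear (entry i).
Proof. by move=> c u v; rewrite /entry !mxE. Qed.

HB.instance Definition _ i :=
  GRing.isLinear.Build R V R^o _ (entry i) (entry_is_linear i).

Definition coordinate (i : 'I_4) : covector V := linfun (entry i).

(* homogeneous coordinates [t:x:y:z] *)
Local Notation t := (coordinate (inord 0)).
Local Notation x := (coordinate (inord 1)).
Local Notation y := (coordinate (inord 2)).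
Local Notation z := (coordinate (inord 3)).

Definition arr (s : seq (covector V)) : {fset {vspace V}} :=
  [fset lker a | a in s]%fset.

Definition arrA4 := arr
  [:: t; x; y; z; x - t; y - t; z - t; x - y; x - z; y - z].

Definition arrD4 := arr
  [:: t - x; t + x; t - y; t + y; t - z; t + z;
      x - y; x + y; x - z; x + z; y - z; y + z].

Definition arrB4 := (arr [:: t; x; y; z] `|` arrD4)%fset.

(* one sign vector from each pair of opposite ones *)
Definition signed_sums : seq (covector V) :=
  [:: t + x + y + z; t + x + y - z; t + x - y + z; t + x - y - z;
      t - x + y + z; t - x + y - z; t - x - y + z; t - x - y - z].

Definition arrF4 := (arrB4 `|` arr signed_sums)%fset.

Definition chain16 := arrB4.
Definition chain15 := (arrB4 `\` arr [:: t])%fset.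
Definition chain14 := (arrB4 `\` arr [:: t; x])%fset.
Definition chain13 := (arrB4 `\` arr [:: t; x; y])%fset.

End CoxeterArrangements.

(* Main.v *)
(* Simpliciality.  If the walls f_1, ..., f_4 of an open simplicial cone are
   among the planes of an arrangement and no plane of the arrangement meets the
   cone, the cone is a chamber; the faces of its closure correspond to the sets
   of vanishing f_i, because a covector which does not vanish on the open cone
   has coefficients of constant sign in the basis (f_i).  All arrangements of
   the chain consist of D4 and some coordinate planes, so the walls around a
   point are found by sorting its coordinates by absolute value.

   Irreducibility.  In a product every plane of the arrangement contains one of
   two complementary subspaces, the same one for two planes as soon as a third
   plane of the arrangement contains their intersection.

   Special vertices.  With a special pair (H, P), each plane b != H can be
   replaced by a plane c through P in the pencil spanned by b and H.  Doing so
   for three planes which are independent together with H leaves finitely many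
   candidates for P. *)
Require Import Defs.
From HB Require Import structures.
From mathcomp Require Import all_boot all_order all_algebra finmap.
From mathcomp Require Import all_classical all_reals all_analysis.
From mathcomp Require Import ring lra.
Set Implicit Arguments.
Unset Strict Implicit.
Unset Printing Implicit Defensive.
Import Order.TTheory GRing.Theory Num.Theory.
Import numFieldNormedType.Exports.
Local Open Scope classical_set_scope.
Local Open Scope ring_scope.

(** * Points and open sets of the projective space *)

Section P3Points.
Context (R : realType).
Local Notation V := 'rV[R]_4.
Implicit Types (p : P3 R) (v w : V) (f : 'I_4 -> covector V).

Lemma point_spanned p : exists2 v : V, v != 0 & point_line p = <[v]>%VS.
Proof.
have dp := point_line_dim p; set L := point_line p in dp *.
have nz : vpick L != 0 by rewrite vpick0 -dimv_eq0 (eqP dp).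
exists (vpick L) => //; apply/eqP; rewrite eq_sym eqEdim -memvE memv_pick /=.
by rewrite (eqP dp) dim_vline nz.
Qed.

Lemma span_point v : v != 0 -> {p | point_line p = <[v]>%VS}.
Proof.
move=> nz; have dv : \dim <[v]>%VS == 1%N by rewrite dim_vline nz.
by exists (Point dv).
Qed.

Lemma spanned_neq0 p v : point_line p = <[v]>%VS -> v != 0.
Proof.
move=> pv; apply/eqP => v0; have := point_line_dim p.
by rewrite pv v0 dim_vline eqxx.
Qed.

Lemma spanned_scale p v w : point_line p = <[v]>%VS -> point_line p = <[w]>%VS ->
  exists2 k : R, k != 0 & w = k *: v.
Proof.
move=> pv pw; have wv : w \in <[v]>%VS by rewrite -pv pw memv_line.
have [k wE] := vlineP _ _ wv.
exists k => //; apply/eqP => k0; have := spanned_neq0 pw.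
by rewrite wE k0 scale0r eqxx.
Qed.

Lemma scale_spanned p v (k : R) : k != 0 -> point_line p = <[v]>%VS ->
  point_line p = <[k *: v]>%VS.
Proof.
move=> k0 ->; apply/eqP; rewrite eqEsubv -!memvE memvZ ?memv_line// andbT.
by rewrite -[v in v \in _](scalerK k0) memvZ ?memv_line.
Qed.

Lemma point_eq p q v : point_line p = <[v]>%VS -> point_line q = <[v]>%VS -> p = q.
Proof. by move=> pv qv; apply: val_inj; rewrite /= pv qv. Qed.

Lemma proj_pointsE (H : {vspace V}) p v : point_line p = <[v]>%VS ->
  proj_points H p <-> v \in H.
Proof. by rewrite /proj_points /= => ->; rewrite -memvE. Qed.

Lemma proj_points_lker (a : covector V) p v : point_line p = <[v]>%VS ->
  proj_points (lker a) p <-> a v = 0.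
Proof.
by move=> pv; rewrite (proj_pointsE _ pv) memv_ker; split=> [/eqP|/eqP].
Qed.

Lemma covector_continuous (a : covector V) : continuous (a : V -> R).
Proof.
have -> : (a : V -> R) = (fun v => \sum_(j < 4) v 0 j * a (delta_mx 0 j)).
  apply/funext => v; rewrite {1}[v]row_sum_delta linear_sum /=.
  by apply: eq_bigr => j _; rewrite linearZ.
under eq_fun do rewrite !big_ord_recl big_ord0 addr0.
move=> v; have FV : Filter (nbhs v) by exact: nbhs_filter.
have H i (c : R) :
    (fun u : V => u 0 i * c : R) x @[x --> v] --> (v 0 i * c : R).
  exact: (cvgM (@coord_continuous R 1 4 0 i v) (cvg_cst _)).
exact: (cvgD (H _ _) (cvgD (H _ _) (cvgD (H _ _) (H _ _)))).
Qed.

Lemma open_covector_gt0 (a : covector V) : open [set v | 0 < (a v : R)].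
Proof.
apply: (@open_comp _ _ (a : V -> R) [set x | 0 < x]); last exact: open_gt.
by move=> v _; exact: covector_continuous.
Qed.

Lemma open_covector_lt0 (a : covector V) : open [set v | (a v : R) < 0].
Proof.
apply: (@open_comp _ _ (a : V -> R) [set x | x < 0]); last exact: open_lt.
by move=> v _; exact: covector_continuous.
Qed.

(** The quotient topology was declared through its cones, so the equivalence holds by conversion. It
    moves every question of openness to [V]. *)
Lemma P3_openP (U : set (P3 R)) : open U <-> open (cone_over U).
Proof. by []. Qed.

Lemma open_forall (P : 'I_4 -> set V) :
  (forall i, open (P i)) -> open [set v | forall i, P i v].
Proof.
move=> oP; rewrite openE => v /= Pv.
apply: (@filter_forall V _ P (nbhs v) (nbhs_filter v)) => i.
exact: (open_nbhs_nbhs (conj (oP i) (Pv i))).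
Qed.

Lemma open_exists (I : Type) (P : I -> set V) :
  (forall i, open (P i)) -> open [set v | exists i, P i v].
Proof.
move=> oP; have -> : [set v | exists i, P i v] = \bigcup_i P i.
  by apply/seteqP; split=> v /= [i]; [exists i|move=> _; exists i].
by apply: bigcup_open => i _; exact: oP.
Qed.

(** A projective point has representatives of both signs, so positivity can only be asked of some
    spanning vector. *)
Definition simplex_cone f : set (P3 R) :=
  [set p | exists2 v : V, point_line p = <[v]>%VS & forall i, 0 < (f i v : R)].

Definition closed_simplex_cone f : set (P3 R) :=
  [set p | exists2 v : V, point_line p = <[v]>%VS & forall i, 0 <= (f i v : R)].

End P3Points.

(** * Simplicial cones *)

Section SimplicialCones.
Context (R : realType).
Local Notation V := 'rV[R]_4.
Context (f : 'I_4 -> covector V).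
Hypothesis f_inj : forall v, (forall i, f i v = 0) -> v = 0.
Implicit Types (p q : P3 R) (v w : V).

(** By [f_inj] the matrix of values of the [f i] on the standard basis is invertible, and the rows
    of its inverse form the dual basis. *)
Lemma dual_basis : exists2 e : 'I_4 -> V,
  forall i j, f i (e j) = (i == j)%:R & forall v, v = \sum_i (f i v : R) *: e i.
Proof.
pose M : 'M[R]_4 := \matrix_(j, i) f i (delta_mx 0 j).
have fM v i : f i v = (v *m M) 0 i.
  rewrite [v in LHS]row_sum_delta linear_sum mxE /=.
  by apply: eq_bigr => j _; rewrite linearZ mxE.
have Mu : M \in unitmx.
  rewrite -row_free_unit; apply: inj_row_free => v vM0.
  by apply: f_inj => i; rewrite fM vM0 mxE.
have fe i j : f i (row j (invmx M)) = (i == j)%:R.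
  by rewrite fM -row_mul mulVmx// !mxE eq_sym.
exists (fun j => row j (invmx M)) => // v.
apply/eqP; rewrite -subr_eq0; apply/eqP/f_inj => i.
rewrite linearB linear_sum (bigD1 i)//= big1 => [|j ji].
  by rewrite linearZ /= fe eqxx addr0 /GRing.scale /= mulr1 subrr.
by rewrite linearZ /= fe eq_sym (negbTE ji) /GRing.scale /= mulr0.
Qed.

Lemma covector_values (u : 'I_4 -> R) : exists v, forall i, f i v = u i.
Proof.
have [e fe _] := dual_basis; exists (\sum_j u j *: e j) => i.
rewrite linear_sum (bigD1 i)//= big1 => [|j ji].
  by rewrite linearZ /= fe eqxx addr0 /GRing.scale /= mulr1.
by rewrite linearZ /= fe eq_sym (negbTE ji) /GRing.scale /= mulr0.
Qed.

(** Both [v] and [- v] may witness membership in the closed cone. Both fail exactly when the [f i]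
    take strictly negative and strictly positive values at [v], which is an open condition. *)
Lemma cone_over_closed_simplex_coneC :
  cone_over (~` closed_simplex_cone f) =
  [set v | exists i, (f i v : R) < 0] `&` [set v | exists j, 0 < (f j v : R)].
Proof.
apply/seteqP; split=> v /=.
  case=> p nKp pv; split; apply: contra_notP nKp => nf.
    exists v => // i; rewrite leNgt; apply/negP => fi; apply: nf; by exists i.
  exists (- v) => [|i].
    by rewrite -scaleN1r; apply: scale_spanned; rewrite ?oppr_eq0 ?oner_eq0.
  rewrite linearN oppr_ge0 leNgt; apply/negP => fi; apply: nf; by exists i.
case=> -[i fi] [j fj]; have vn0 : v != 0.
  by apply/eqP => v0; move: fi; rewrite v0 linear0 ltxx.
have [p pv] := span_point vn0; exists p => // -[w pw fw].
have [k k0 wE] := spanned_scale pv pw.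
have := fw i; have := fw j; rewrite wE !linearZ /=.
rewrite pmulr_lge0// nmulr_lge0// => k1 k2.
by move: k0; rewrite (le_anti (introT andP (conj k2 k1))) eqxx.
Qed.

Lemma closed_simplex_cone_closed : closed (closed_simplex_cone f).
Proof.
rewrite -openC; apply/P3_openP; rewrite cone_over_closed_simplex_coneC.
apply: openI; apply: open_exists => i;
  [exact: open_covector_lt0|exact: open_covector_gt0].
Qed.

Lemma simplex_cone_open : open (simplex_cone f).
Proof.
apply/P3_openP; have -> : cone_over (simplex_cone f) =
    [set v | forall i, 0 < (f i v : R)] `|` [set v | forall i, (f i v : R) < 0].
  apply/seteqP; split=> v /=.
    case=> p [w pw fw] pv; have [k k0 wE] := spanned_scale pv pw.
    case: (ltrgt0P k) k0 => // k_s _; [left|right] => i; have := fw i;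
      rewrite wE linearZ /=; first by rewrite pmulr_rgt0.
    by rewrite nmulr_rgt0.
  case=> fv.
    have vn0 : v != 0.
      by apply/eqP => v0; have := fv ord0; rewrite v0 linear0 ltxx.
    by have [p pv] := span_point vn0; exists p => //; exists v.
  have vn0 : v != 0.
    by apply/eqP => v0; have := fv ord0; rewrite v0 linear0 ltxx.
  have [p pv] := span_point vn0; exists p => //; exists (- v) => [|i].
    by rewrite -scaleN1r; apply: scale_spanned; rewrite ?oppr_eq0 ?oner_eq0.
  by rewrite linearN oppr_gt0; exact: fv.
apply: openU; [apply: (open_forall (P := fun i => [set v | 0 < (f i v : R)]))
              |apply: (open_forall (P := fun i => [set v | (f i v : R) < 0]))] => i.
  exact: open_covector_gt0.
exact: open_covector_lt0.
Qed.

Lemma line_continuous v w : continuous (fun s : R => v + s *: w).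
Proof. by move=> s; apply: cvgD; [exact: cvg_cst|exact: scalel_continuous]. Qed.

(** Positive representatives of two points are joined by a segment on which all [f i] stay positive.
    A relatively clopen subset is pulled back to this segment, where [segment_connected] applies. *)
Lemma simplex_cone_connected : connected (simplex_cone f).
Proof.
move=> B [p Bp] [C oC BC] [D cD BD].
have [v pv fv] : simplex_cone f p by move: Bp; rewrite BC => -[].
apply/seteqP; split=> [q|q [w qw fw]]; first by rewrite BC => -[].
pose g (s : R) : V := v + s *: (w - v).
have gc : continuous g by exact: line_continuous.
have fg i s : `[0, 1]%classic s -> 0 < (f i (g s) : R).
  rewrite /= in_itv /= => /andP[s0 s1]; rewrite linearD linearZ linearB /=.
  have := fv i; have := fw i; rewrite /GRing.scale /=.
  set a : R := f i w; set b : R := f i v => a0 b0; nra.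
have gn0 s : `[0, 1]%classic s -> g s != 0.
  by move=> s01; apply/eqP => g0; have := fg ord0 s s01; rewrite g0 linear0 ltxx.
have Kg s r : `[0, 1]%classic s -> point_line r = <[g s]>%VS -> simplex_cone f r.
  by move=> s01 rg; exists (g s) => // i; exact: fg.
pose S : set R := `[0, 1]%classic `&` g @^-1` cone_over C.
have S01 : S = `[0, 1]%classic.
  apply: (@segment_connected R 0 1).
  - exists 0; split; first by rewrite /= in_itv /= lexx ler01.
    by exists p; rewrite /= ?/g ?scale0r ?addr0//; move: Bp; rewrite BC => -[].
  - exists (g @^-1` cone_over C) => //.
    by apply: open_comp; [move=> s _; exact: gc|exact: oC].
  (* On the segment, lying in [C] and lying in [D] both mean lying in [B], so the closed set [D]
     shows that [S] is relatively closed. *)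
  - exists (~` (g @^-1` cone_over (~` D))).
      apply: open_closedC; apply: open_comp; first by move=> s _; exact: gc.
      by apply: (proj1 (P3_openP _)); rewrite openC.
    apply/seteqP; split=> s [s01]; rewrite /preimage /=.
      case=> r Cr rg; split=> // -[r' nDr' r'g]; apply: nDr'.
      rewrite (point_eq r'g rg); have : B r by rewrite BC; split=> //; exact: Kg rg.
      by rewrite BD => -[].
    move=> nD; split=> //; have [r rg] := span_point (gn0 s s01).
    exists r => //; have : B r.
      rewrite BD; split; first exact: Kg rg.
      by apply: contra_notP nD => nDr; exists r.
    by rewrite BC => -[].
have : S 1 by rewrite S01 /= in_itv /= lexx ler01.
case=> _ [r Cr]; rewrite /g scale1r addrC subrK => rw.
by rewrite (point_eq qw rw) BC; split=> //; exists w.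
Qed.

Lemma closure_simplex_cone : closure (simplex_cone f) = closed_simplex_cone f.
Proof.
apply/seteqP; split=> [p clp|p [v pv fv] B].
  apply: closed_simplex_cone_closed; apply: closure_subset clp => q [v qv fv].
  by exists v => // i; exact: ltW.
(* Moving from [v] in the direction [w] raises every [f i] at unit speed, so a boundary point is a
   limit of points of the open cone. *)
have [w fw] := covector_values (fun=> 1).
rewrite nbhsE => -[U [oU Up] UB].
pose g (s : R) : V := v + s *: w.
have : nbhs (0 : R) (g @^-1` cone_over U).
  apply: line_continuous; apply: open_nbhs_nbhs; split; first exact: oU.
  by exists p => //; rewrite scale0r addr0.
case/nbhs_ballP => e /= e0 /(_ (e / 2)) [].
  by rewrite /ball /= sub0r normrN gtr0_norm ?divr_gt0// ltr_pdivrMr// ltr_pMr// ltr1n.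
move=> q Uq qg; exists q; split; last exact: UB.
exists (g (e / 2)) => // i; rewrite linearD linearZ /= fw /GRing.scale /= mulr1.
by rewrite ltr_wpDl ?divr_gt0.
Qed.

(** The open cone is clopen in the complement: no [f i] vanishes there, so the closed cone cuts out
    the same subset as the open one. *)
Lemma connected_component_simplex_cone (A : {fset {vspace V}}) p :
  simplex_cone f `<=` arrangement_complement A ->
  (forall q v, arrangement_complement A q -> point_line q = <[v]>%VS ->
     forall i, f i v <> 0) ->
  simplex_cone f p ->
  connected_component (arrangement_complement A) p = simplex_cone f.
Proof.
move=> KA fA Kp; apply/seteqP; split; last first.
  exact: connected_component_max KA simplex_cone_connected.
set Q := connected_component _ _.
have QA : Q `<=` arrangement_complement A by exact: connected_component_sub.
suff <- : Q `&` simplex_cone f = Q by move=> q [].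
have cQ : connected Q by exact: component_connected.
apply: (cQ (Q `&` simplex_cone f)).
- by exists p; split=> //; apply: connected_component_refl; exact: KA.
- by exists (simplex_cone f) => //; exact: simplex_cone_open.
- exists (closed_simplex_cone f); first exact: closed_simplex_cone_closed.
  apply/seteqP; split=> q [Qq] [v qv fv]; split=> //; exists v => // i.
    exact: ltW.
  by rewrite lt_def fv andbT; apply/eqP; exact: fA (QA _ Qq) qv i.
Qed.

(** [S] is the set of vertices of the face: vertex [i] is the dual basis vector on which only [f i]
    is nonzero. *)
Definition simplex_cone_face (S : {set 'I_4}) : set (P3 R) :=
  [set p | exists2 v : V, point_line p = <[v]>%VS &
     forall i, 0 <= (f i v : R) /\ (i \notin S -> f i v = 0)].

Lemma simplex_cone_faceT : simplex_cone_face [set: 'I_4]%SET = closed_simplex_cone f.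
Proof.
apply/seteqP; split=> p [v pv fv]; exists v => // i; first by case: (fv i).
by split; [exact: fv|rewrite inE].
Qed.

Lemma simplex_cone_face_subset S T :
  simplex_cone_face S `<=` simplex_cone_face T <-> S \subset T.
Proof.
split=> [ST|/fintype.subsetP ST p [v pv fv]]; last first.
  exists v => // i; have [fi0 fiS] := fv i; split=> // iT.
  by apply: fiS; apply: contra iT; exact: ST.
have [e fe _] := dual_basis; apply/fintype.subsetP => i iS.
have en0 : e i != 0.
  apply/eqP => e0; have := fe i i; rewrite e0 linear0 eqxx => /esym/eqP.
  by rewrite oner_eq0.
have [p pe] := span_point en0.
have /ST[v pv fv] : simplex_cone_face S p.
  exists (e i) => // j; rewrite fe ler0n; split=> // jS.
  by case: eqP jS => // ->; rewrite iS.
apply/negPn/negP => iT; have [k k0 vE] := spanned_scale pe pv.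
have [_ /(_ iT)] := fv i; rewrite vE linearZ /= fe eqxx /GRing.scale /= mulr1.
by move/eqP; rewrite (negbTE k0).
Qed.

Lemma simplex_cone_face_face S : face (simplex_cone f) (simplex_cone_face S).
Proof.
have [->|] := eqVneq S [set: 'I_4]%SET.
  by left; rewrite closure_simplex_cone simplex_cone_faceT.
rewrite -finset.subTset => /fintype.subsetPn[j _ jS]; right.
(* On the closed cone this sum of nonnegative terms vanishes only where every [f i] with [i] outside
   [S] does; its plane therefore supports the cone along the face. *)
pose a : covector V := \sum_(i | i \notin S) f i.
have aE v : a v = \sum_(i | i \notin S) (f i v : R) by rewrite sum_lfunE.
have a_gt0 v : (forall i, 0 < (f i v : R)) -> 0 < (a v : R).
  move=> fv; rewrite aE (bigD1 j)//= ltr_wpDr// sumr_ge0// => i _; exact: ltW.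
exists a; split.
- have [w fw] := covector_values (fun=> 1).
  apply/eqP => a0; have := @a_gt0 w; rewrite a0 lfunE /= ltxx => H.
  by suff : false by []; apply: H => i; rewrite fw.
- apply/seteqP; split=> // p [/proj_points_lker pa [v pv /a_gt0]].
  by rewrite (pa _ pv) ltxx.
- rewrite closure_simplex_cone; apply/seteqP; split=> p.
    case=> v pv fv; split; first by exists v => // i; case: (fv i).
    apply/(proj_points_lker _ pv); rewrite aE big1// => i iS.
    by have [_ ->] := fv i.
  case=> -[v pv fv] /(proj_points_lker _ pv); rewrite aE => /eqP.
  rewrite psumr_eq0 => [/allP av0|i _]; last exact: fv.
  exists v => // i; split=> // iS; apply/eqP.
  by have := av0 i (mem_index_enum _); rewrite iS.
Qed.

Lemma face_simplex_cone F :
  face (simplex_cone f) F -> exists S, F = simplex_cone_face S.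
Proof.
case=> [->|[a [_ aC ->]]].
  by exists [set: 'I_4]%SET; rewrite closure_simplex_cone simplex_cone_faceT.
have [e fe eE] := dual_basis; pose c i : R := a (e i).
have aE v : a v = \sum_i (f i v : R) * c i.
  by rewrite {1}[v]eE linear_sum /=; apply: eq_bigr => i _; rewrite linearZ.
have csign : (forall i, 0 <= c i) \/ (forall i, c i <= 0).
  apply: contrapT => /not_orP[] /existsNP[i /negP] + /existsNP[j /negP].
  rewrite -!ltNge => ci cj.
  (* Where all [f m] equal 1, the value of [a] is the sum of the [c m]. With coefficients of both
     signs available, raising a single [f k] by [l] brings this value to 0 inside the open cone,
     against [aC]. *)
  suff [k [l l0 lE]] : exists k, exists2 l, 0 <= l & \sum_m c m + l * c k = 0.
    have [v fv] := covector_values (fun m => 1 + (m == k)%:R * l).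
    have v_gt0 m : 0 < (f m v : R).
      by rewrite fv ltr_wpDr// mulr_ge0// ler0n.
    have av0 : a v = 0.
      rewrite aE -[RHS]lE (eq_bigr (fun m => c m + (m == k)%:R * l * c m)).
        rewrite big_split /= [X in _ + X](bigD1 k)//= eqxx mul1r.
        by rewrite [X in _ + (_ + X)]big1 ?addr0// => m /negbTE->; rewrite !mul0r.
      by move=> m _; rewrite fv mulrDl mul1r.
    have vn0 : v != 0.
      by apply/eqP => v0; have := v_gt0 ord0; rewrite v0 linear0 ltxx.
    have [p pv] := span_point vn0.
    suff : (set0 : set (P3 R)) p by [].
    rewrite -aC; split; first exact/(proj_points_lker _ pv).
    by exists v.
  have [s0|s0] := leP (\sum_m c m) 0.
    exists j, (- (\sum_m c m) / c j); first by rewrite divr_ge0 ?oppr_ge0 // ltW.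
    by rewrite divfK ?gt_eqF// subrr.
  exists i, (- (\sum_m c m) / c i); last by rewrite divfK ?lt_eqF// subrr.
  by rewrite -mulrNN -invrN opprK mulr_ge0// ?invr_ge0 ?oppr_ge0 ltW.
(* With coefficients of constant sign, [a v] is a sum of terms of one sign and vanishes only if each
   term does. *)
have aP v : (forall i, 0 <= (f i v : R)) ->
    (a v = 0) <-> (forall i, c i != 0 -> f i v = 0).
  move=> fv; split=> [av0 i ci0|fc]; last first.
    rewrite aE big1// => i _; have [->|/fc->] := eqVneq (c i) 0.
      by rewrite mulr0.
    by rewrite mul0r.
  have : (f i v : R) * c i = 0.
    have [c0|c0] := csign; apply/eqP; move/eqP: av0.
      rewrite aE psumr_eq0 => [/allP/(_ i (mem_index_enum _))//|j _].
      exact: mulr_ge0.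
    rewrite -oppr_eq0 aE -sumrN psumr_eq0 => [/allP/(_ i (mem_index_enum _))|j _].
      by rewrite oppr_eq0.
    by rewrite -mulrN mulr_ge0// oppr_ge0.
  by move/eqP; rewrite mulf_eq0 (negbTE ci0) orbF => /eqP.
exists [set i | c i == 0]%SET; rewrite closure_simplex_cone.
apply/seteqP; split=> p.
  case=> -[v pv fv] /(proj_points_lker _ pv)/(aP _ fv) fc.
  by exists v => // i; split=> //; rewrite inE => /fc.
case=> v pv fv; have fv0 i : 0 <= (f i v : R) by case: (fv i).
split; first by exists v.
apply/(proj_points_lker _ pv)/(aP _ fv0) => i ci.
by have [_ ->] := fv i; rewrite ?inE.
Qed.

Lemma tetrahedron_simplex_cone : tetrahedron (simplex_cone f).
Proof.
exists simplex_cone_face; split; last exact: simplex_cone_face_subset.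
apply/seteqP; split=> [_ [S _ <-]|F /face_simplex_cone[S ->]].
  exact: simplex_cone_face_face.
by exists S.
Qed.

End SimplicialCones.

(** * Planes with integral equations *)

Notation quad := (int * int * int * int)%type.

Section IntegralCovectors.
Context (R : realType).
Local Notation V := 'rV[R]_4.
Implicit Types (a b c d : quad) (v : V) (l : seq quad).

(** Integer coefficients turn the incidence questions below into computations that do not depend on
    [R]. *)
Definition int_covector (a : quad) : covector V :=
  coordinate R (inord 0) *~ a.1.1.1 + coordinate R (inord 1) *~ a.1.1.2 +
  coordinate R (inord 2) *~ a.1.2 + coordinate R (inord 3) *~ a.2.

Definition qdot (a b : quad) : int :=
  a.1.1.1 * b.1.1.1 + a.1.1.2 * b.1.1.2 + a.1.2 * b.1.2 + a.2 * b.2.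

Local Notation icov := int_covector.

Lemma icovE a v : icov a v =
  a.1.1.1%:~R * v 0 (inord 0) + a.1.1.2%:~R * v 0 (inord 1) +
  a.1.2%:~R * v 0 (inord 2) + a.2%:~R * v 0 (inord 3) :> R.
Proof.
have cE i (n : int) : (coordinate R i *~ n) v = n%:~R * v 0 i :> R.
  by rewrite -scaler_int scale_lfunE lfunE.
by rewrite /int_covector !add_lfunE !cE.
Qed.

Lemma icovD a b : icov (a + b) = icov a + icov b.
Proof. by apply/lfunP => v; rewrite add_lfunE !icovE /= !rmorphD /=; ring. Qed.

Lemma icovN a : icov (- a) = - icov a.
Proof. by apply/lfunP => v; rewrite opp_lfunE !icovE /= !rmorphN /=; ring. Qed.

Lemma icovB a b : icov (a - b) = icov a - icov b.
Proof. by rewrite icovD icovN. Qed.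

HB.instance Definition _ :=
  GRing.isZmodMorphism.Build quad (covector V) icov icovB.

Lemma icov_comb a b (m n : int) v :
  icov (a *~ m + b *~ n) v = m%:~R * icov a v + n%:~R * icov b v :> R.
Proof.
have icovMz c (k : int) : icov (c *~ k) v = k%:~R * icov c v :> R.
  by rewrite raddfMz -scaler_int scale_lfunE.
have -> := icovD (a *~ m) (b *~ n).
by rewrite add_lfunE (icovMz a m) (icovMz b n).
Qed.

Lemma forall_ord4 (P : 'I_4 -> Prop) :
  P (inord 0) -> P (inord 1) -> P (inord 2) -> P (inord 3) -> forall i, P i.
Proof.
move=> P0 P1 P2 P3 i; rewrite -[i]inord_val.
by case: i => -[|[|[|[|]]]].
Qed.

Definition qvec (w0 w1 w2 w3 : R) : V := \row_i nth 0 [:: w0; w1; w2; w3] i.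

Lemma qvecE w0 w1 w2 w3 :
  [/\ qvec w0 w1 w2 w3 0 (inord 0) = w0, qvec w0 w1 w2 w3 0 (inord 1) = w1,
      qvec w0 w1 w2 w3 0 (inord 2) = w2 & qvec w0 w1 w2 w3 0 (inord 3) = w3].
Proof. by rewrite !mxE !inordK. Qed.

Lemma icov_qvec a w0 w1 w2 w3 : icov a (qvec w0 w1 w2 w3) =
  a.1.1.1%:~R * w0 + a.1.1.2%:~R * w1 + a.1.2%:~R * w2 + a.2%:~R * w3 :> R.
Proof. by rewrite icovE; have [-> -> -> ->] := qvecE w0 w1 w2 w3. Qed.

Lemma icov_eq0 a : (icov a == 0) = (a == 0).
Proof.
apply/eqP/eqP => [a0|->]; last by rewrite -[0 in LHS](subrr 0) icovB subrr.
have H w0 w1 w2 w3 := icov_qvec a w0 w1 w2 w3.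
have := H 1 0 0 0; have := H 0 1 0 0; have := H 0 0 1 0; have := H 0 0 0 1.
case: a {H} a0 => [[[a0 a1] a2] a3] -> /=; rewrite !lfunE /= !mulr0 !mulr1 !addr0 !add0r.
by do 4![move=> /esym/eqP; rewrite intr_eq0 => /eqP ->].
Qed.

Lemma mem_arr (s : seq (covector V)) (H : {vspace V}) :
  reflect (exists2 a, a \in s & H = lker a) (H \in arr s).
Proof.
by apply: (iffP (imfsetP _ _ _ _)) => -[a /= sa ->]; exists a.
Qed.

Lemma mem_icov_arr l (H : {vspace V}) :
  reflect (exists2 a, a \in l & H = lker (icov a)) (H \in arr [seq icov a | a <- l]).
Proof.
apply: (iffP (mem_arr _ _)) => [[_ /mapP[a la ->] ->]|[a la ->]]; first by exists a.
by exists (icov a) => //; exact: map_f.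
Qed.

(** The six 2 x 2 minors vanish: a decidable form of proportionality. *)
Definition parallel a b :=
  [&& a.1.1.1 * b.1.1.2 == a.1.1.2 * b.1.1.1,
      a.1.1.1 * b.1.2 == a.1.2 * b.1.1.1, a.1.1.1 * b.2 == a.2 * b.1.1.1,
      a.1.1.2 * b.1.2 == a.1.2 * b.1.1.2, a.1.1.2 * b.2 == a.2 * b.1.1.2 &
      a.1.2 * b.2 == a.2 * b.1.2].

(** The minors give [a_i * b(v) = b_i * a(v)] for each coefficient, so [a(v) = 0] and [b(v) != 0]
    would force all [a_i] to be zero. *)
Lemma parallelP a b : parallel a b ->
  forall v, icov a v = 0 -> a != 0 -> icov b v = 0.
Proof.
case: a b => [[[a0 a1] a2] a3] [[[b0 b1] b2] b3] H v av.
have {H} H : forall i : R, i \in [:: a0%:~R; a1%:~R; a2%:~R; a3%:~R] ->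
    exists k, i * icov (b0, b1, b2, b3) v = k * icov (a0, a1, a2, a3) v :> R.
  have E (m n p q : int) : m * n == p * q -> m%:~R * n%:~R = p%:~R * q%:~R :> R.
    by move=> /eqP e; rewrite -!intrM e.
  move: H; rewrite /parallel /= => /and5P[] /E e1 /E e2 /E e3 /E e4 /andP[/E e5 /E e6].
  move=> i; rewrite !inE; case/or4P => /eqP ->;
    [exists b0%:~R|exists b1%:~R|exists b2%:~R|exists b3%:~R];
    rewrite !icovE /= !mulrDr !mulrA.
  - by rewrite e1 e2 e3; ring.
  - by rewrite -e1 e4 e5; ring.
  - by rewrite -e2 -e4 e6; ring.
  - by rewrite -e3 -e5 -e6; ring.
move=> an0; apply/eqP; apply: contraNT an0 => bv.
have z (n : int) : n%:~R \in [:: a0%:~R; a1%:~R; a2%:~R; a3%:~R : R] -> n = 0.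
  move=> /H[k]; rewrite av mulr0 => /eqP.
  by rewrite mulf_eq0 (negbTE bv) orbF intr_eq0 => /eqP.
have -> : a0 = 0 by apply: z; rewrite mem_head.
have -> : a1 = 0 by apply: z; rewrite in_cons mem_head orbT.
have -> : a2 = 0 by apply: z; rewrite 2!in_cons mem_head !orbT.
by have -> : a3 = 0 by apply: z; rewrite 3!in_cons mem_head !orbT.
Qed.

Lemma parallel_lker a b : a != 0 -> b != 0 ->
  (lker (icov a) == lker (icov b)) = parallel a b.
Proof.
move=> an0 bn0; apply/eqP/idP => [|ab].
  move=> kE; have K (v : V) : icov b v = 0 -> icov a v = 0.
    by move=> bv; apply/eqP; rewrite -memv_ker kE memv_ker bv.
  have E (m n p q : int) :  m%:~R * n%:~R - p%:~R * q%:~R = 0 :> R -> m * n == p * q.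
    by move=> e; rewrite -(eqr_int R) !intrM -subr_eq0 e.
  (* Each minor is the value of [a] at a vector with entries [b_j] and [- b_i] in places [i] and
     [j], which [b] kills. *)
  have H w0 w1 w2 w3 := K (qvec w0 w1 w2 w3).
  move: H; case: a b {K kE an0 bn0} => [[[a0 a1] a2] a3] [[[b0 b1] b2] b3] H.
  have {}H w0 w1 w2 w3 : b0%:~R * w0 + b1%:~R * w1 + b2%:~R * w2 + b3%:~R * w3 = 0 :> R ->
     a0%:~R * w0 + a1%:~R * w1 + a2%:~R * w2 + a3%:~R * w3 = 0 :> R.
    by have := H w0 w1 w2 w3; rewrite !icov_qvec.
  rewrite /parallel /=; apply/and5P; split; last (apply/andP; split); apply: E.
  - by rewrite -[RHS](H b1%:~R (- b0%:~R) 0 0); ring.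
  - by rewrite -[RHS](H b2%:~R 0 (- b0%:~R) 0); ring.
  - by rewrite -[RHS](H b3%:~R 0 0 (- b0%:~R)); ring.
  - by rewrite -[RHS](H 0 b2%:~R (- b1%:~R) 0); ring.
  - by rewrite -[RHS](H 0 b3%:~R 0 (- b1%:~R)); ring.
  - by rewrite -[RHS](H 0 0 b3%:~R (- b2%:~R)); ring.
have ba : parallel b a.
  move: ab; rewrite /parallel => /and5P[e1 e2 e3 e4 /andP[e5 e6]].
  by apply/and5P; split; last (apply/andP; split);
    rewrite eq_sym [X in X == _]mulrC [X in _ == X]mulrC.
apply/vspaceP => v; rewrite !memv_ker; apply/eqP/eqP => e; exact: parallelP e _.
Qed.

End IntegralCovectors.

(** * Computable criteria for essential and irreducible arrangements *)

Section IntegralArrangements.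
Context (R : realType).
Local Notation V := 'rV[R]_4.
Local Notation icov := (@int_covector R).
Implicit Types (a b c d : quad) (v : V) (l : seq quad).

Definition iarr l : {fset {vspace V}} := arr [seq icov a | a <- l].

Lemma mem_iarr l (H : {vspace V}) :
  reflect (exists2 a, a \in l & H = lker (icov a)) (H \in iarr l).
Proof. exact: mem_icov_arr. Qed.

Lemma iarrD l l' : 0 \notin l -> 0 \notin l' ->
  (iarr l `\` iarr l')%fset = iarr [seq a <- l | ~~ has (parallel a) l'].
Proof.
move=> l0 l'0; apply/fsetP => H; rewrite in_fsetD.
have nz (s : seq quad) a : 0 \notin s -> a \in s -> a != 0.
  by move=> s0 sa; apply: contraNneq s0 => <-.
apply/andP/mem_iarr => [[nl' /mem_iarr[a la HE]]|[a]].
  exists a => //; rewrite mem_filter la andbT; apply: contra nl'.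
  case/hasP => b l'b ab; apply/mem_iarr; exists b => //; rewrite HE.
  by apply/eqP; rewrite parallel_lker ?(nz l a) ?(nz l' b).
rewrite mem_filter => /andP[nl' la] HE; split; last by apply/mem_iarr; exists a.
apply: contra nl' => /mem_iarr[b l'b HE']; apply/hasP; exists b => //.
by rewrite -(@parallel_lker R) ?(nz l a) ?(nz l' b)// -HE -HE'.
Qed.

Lemma iarr_proper l l' : 0 \notin l -> 0 \notin l' -> {subset l <= l'} ->
  has (fun a => ~~ has (parallel a) l) l' -> (iarr l `<` iarr l')%fset.
Proof.
move=> l0 l'0 ll' /hasP[a l'a nla].
rewrite fproperE; apply/andP; split.
  apply/fsubsetP => H /mem_iarr[b lb ->].
  by apply/mem_iarr; exists b => //; exact: ll'.
apply/negP => /fsubsetP/(_ (lker (icov a))).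
case/(_ _)/mem_iarr => [|b lb /eqP ab]; first by apply/mem_iarr; exists a.
move/negP: nla; apply; apply/hasP; exists b => //.
by rewrite -(@parallel_lker R)//; 
  [apply: contraNneq l'0 => <-|apply: contraNneq l0 => <-].
Qed.

Definition basis_quads : seq quad :=
  [:: (1, 0, 0, 0); (0, 1, 0, 0); (0, 0, 1, 0); (0, 0, 0, 1)].

(** The doubled basis vectors are used because D4 yields [2 t] as [(t - x) + (t + x)]; when [e]
    itself lies in [l], [a = b = e] works. *)
Definition spanning l :=
  all (fun e => has (fun a => has (fun b =>
    (a + b == e *+ 2) || (a - b == e *+ 2)) l) l) basis_quads.

Lemma same_kernel_line (a b : covector V) : a != 0 -> lker a = lker b -> b \in <[a]>%VS.
Proof.
move=> an0 kE.
have [v av] : exists v, a v != 0.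
  apply: contrapT => /forallNP av; move/eqP: an0; apply; apply/lfunP => v.
  by rewrite lfunE; apply/eqP/negPn/negP/av.
apply/vlineP; exists ((b v : R) / (a v : R)); apply/lfunP => w; rewrite scale_lfunE.
have : w - ((a w : R) / (a v : R)) *: v \in lker b.
  by rewrite -kE memv_ker linearB linearZ /= /GRing.scale /= divfK// subrr.
rewrite memv_ker linearB linearZ /= subr_eq0 => /eqP ->.
rewrite /GRing.scale /=; set x : R := a w; set y : R := a v; set z : R := b v; ring.
Qed.

Lemma essential_iarr l : 0 \notin l -> spanning l -> essential (iarr l).
Proof.
move=> l0 /allP sl.
have nz a : a \in l -> icov a != 0.
  by move=> la; rewrite icov_eq0; apply: contraNneq l0 => <-.
(* [essential] asks for a function on planes, so each plane gets the first equation in [l] that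
   defines it. *)
pose h (H : {vspace V}) := icov (nth 0 l (find (fun a => lker (icov a) == H) l)).
have hP H : H \in iarr l -> h H != 0 /\ lker (h H) = H.
  case/mem_iarr => a la HE.
  have hl : has (fun a => lker (icov a) == H) l by apply/hasP; exists a; rewrite ?HE.
  split; first by apply: nz; apply: mem_nth; rewrite -has_find.
  by apply/eqP; have := nth_find 0 hl.
exists h; split=> //; set W := <<_>>%VS.
have lW a : a \in l -> icov a \in W.
  move=> la; have Hl : lker (icov a) \in iarr l by apply/mem_iarr; exists a.
  have [hn0 hk] := hP _ Hl; have : h (lker (icov a)) \in W.
    by apply: memv_span; apply/mapP; exists (lker (icov a)).
  by rewrite memvE => hW; apply: (subvP hW); exact: same_kernel_line.
have eW e : e \in basis_quads -> icov e \in W.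
  move=> /sl/hasP[a la /hasP[b lb abe]].
  have -> : icov e = 2^-1 *: icov (e *+ 2).
    by rewrite raddfMn /= -(scaler_nat 2 (icov e)) scalerA mulVf ?scale1r// pnatr_eq0.
  apply: memvZ; case/orP: abe => /eqP <-.
    by rewrite icovD; apply: memvD; exact: lW.
  by rewrite icovB; apply: memvB; exact: lW.
have cW i : coordinate R i \in W.
  move: i; apply: forall_ord4.
  - by have := eW (1, 0, 0, 0) isT; rewrite /int_covector /= mulr1z !mulr0z !addr0.
  - by have := eW (0, 1, 0, 0) isT; rewrite /int_covector /= mulr1z !mulr0z !addr0 !add0r.
  - by have := eW (0, 0, 1, 0) isT; rewrite /int_covector /= mulr1z !mulr0z !addr0 !add0r.
  - by have := eW (0, 0, 0, 1) isT; rewrite /int_covector /= mulr1z !mulr0z !add0r.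
apply/vspaceP => c; rewrite memvf; apply/idP.
have -> : c = \sum_i (c (delta_mx 0 i) : R) *: coordinate R i.
  apply/lfunP => v; rewrite sum_lfunE {1}[v]row_sum_delta linear_sum.
  apply: eq_bigr => i _; rewrite linearZ scale_lfunE lfunE /= /entry.
  by rewrite /GRing.scale /= mulrC.
by apply: memv_suml => i _; apply: memvZ; exact: cW.
Qed.

(* The coefficient 2 is needed because z = 0 may be linked to t - z = 0 only
   through t + z = (t - z) + 2 z. *)
Definition linked l a b := has (fun k : int * int =>
    [&& k.1 != 0, k.2 != 0 & a *~ k.1 + b *~ k.2 \in l])
  [:: (1, 1); (1, -1); (-1, 1); (-1, -1); (1, 2); (2, 1)].

(** Each round replaces the current list by its neighbours in [l], so this collects the ends of
    walks with exactly three links. *)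
Definition reach l a :=
  iter 3 (fun s => [seq b <- l | has (linked l ^~ b) s]) [:: a].

Definition connected_quads l := all [in reach l (head 0 l)] l.

Definition vanishes_on (L : set V) a := forall v, L v -> icov a v = 0.

(** Suppose [b] vanished on [L']. The linking combination vanishes on [L] or on [L']; the first
    forces [b] to vanish on [L], the second makes [a] vanish on both sets, which is excluded. *)
Lemma linked_vanishes l (L L' : set V) a b :
  (forall c, c \in l -> vanishes_on L c \/ vanishes_on L' c) ->
  (forall c, c \in l -> ~ (vanishes_on L c /\ vanishes_on L' c)) ->
  a \in l -> b \in l -> linked l a b -> vanishes_on L a -> vanishes_on L b.
Proof.
move=> LL' nLL' la lb /hasP[[m n] _ /and3P[/= m0 n0 lc]] La.
have [//|L'b] := LL' b lb; have [Lc|L'c] := LL' _ lc.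
  move=> v Lv; have /eqP := Lc v Lv; rewrite icov_comb La// mulr0 add0r.
  by rewrite mulf_eq0 intr_eq0 (negbTE n0) => /eqP.
case: (nLL' a la); split=> // v L'v; have /eqP := L'c v L'v.
by rewrite icov_comb L'b// mulr0 addr0 mulf_eq0 intr_eq0 (negbTE m0) => /eqP.
Qed.

Lemma reach_vanishes l (L L' : set V) a :
  (forall c, c \in l -> vanishes_on L c \/ vanishes_on L' c) ->
  (forall c, c \in l -> ~ (vanishes_on L c /\ vanishes_on L' c)) ->
  a \in l -> vanishes_on L a -> forall b, b \in reach l a -> vanishes_on L b.
Proof.
move=> LL' nLL' la La.
suff H b : b \in reach l a -> b \in l /\ vanishes_on L b by move=> b /H[].
rewrite /reach; elim: 3%N b => [|n IHn] b; first by rewrite inE => /eqP ->.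
rewrite iterS mem_filter => /andP[/hasP[c /IHn[lc Lc] cb] lb]; split=> //.
exact: linked_vanishes LL' nLL' lc lb cb Lc.
Qed.

Lemma irreducible_iarr l : 0 \notin l -> connected_quads l -> irreducible (iarr l).
Proof.
move=> l0 /allP cl [p [q [A1 [A2 [g [gbij _ [A1n A2n] _ gA]]]]]].
(* These are the preimages of the two factors: planes coming from [A1] contain [L], those coming
   from [A2] contain [L']. *)
pose L : set V := [set v | (g v).1 = 0]; pose L' : set V := [set v | (g v).2 = 0].
have inL a (H1 : {vspace 'rV[R]_p}) :
    (g @: lker (icov a) = linfun (@fst _ 'rV[R]_q) @^-1: H1)%VS -> vanishes_on L a.
  move=> e v gv; apply/eqP; rewrite -memv_ker.
  have : (g v \in g @: lker (icov a))%VS by rewrite e -memv_preim lfunE /= gv mem0v.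
  by case/memv_imgP => w wa /(bij_inj gbij) ->.
have inL' a (H2 : {vspace 'rV[R]_q}) :
    (g @: lker (icov a) = linfun (@snd 'rV[R]_p _) @^-1: H2)%VS -> vanishes_on L' a.
  move=> e v gv; apply/eqP; rewrite -memv_ker.
  have : (g v \in g @: lker (icov a))%VS by rewrite e -memv_preim lfunE /= gv mem0v.
  by case/memv_imgP => w wa /(bij_inj gbij) ->.
have LL' a : a \in l -> vanishes_on L a \/ vanishes_on L' a.
  move=> la; have : (g @: lker (icov a))%VS \in product_arrangement A1 A2.
    by rewrite -gA; apply/imfsetP; exists (lker (icov a)) => //; apply/mem_iarr; exists a.
  case/fsetUP => /imfsetP[H _ e]; [left; exact: inL e|right; exact: inL' e].
(* [L] and [L'] together span the space, so a covector vanishing on both is zero. *)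
have nLL' a : a \in l -> ~ (vanishes_on L a /\ vanishes_on L' a).
  move=> la [La L'a].
  suff : icov a = 0 by move/eqP; rewrite icov_eq0 => /eqP a0; move: l0; rewrite -a0 la.
  have [g' gK g'K] := gbij.
  apply/lfunP => v; rewrite zero_lfunE.
  have -> : v = g' ((g v).1, 0) + g' (0, (g v).2).
    apply: (can_inj gK); rewrite linearD /= !g'K; case: (g v) => x y /=.
    by congr pair; rewrite ?addr0 ?add0r.
  rewrite (linearD (icov a)) /= [X in _ + X]La ?L'a ?addr0//;
    by rewrite /L /L' /= g'K.
have [H1 A1H1] := fset0Pn _ A1n; have [H2 A2H2] := fset0Pn _ A2n.
have memA (K : {vspace 'rV[R]_p * 'rV[R]_q}) : K \in product_arrangement A1 A2 ->
    exists2 a, a \in l & K = (g @: lker (icov a))%VS.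
  by rewrite -gA => /imfsetP[_ /mem_iarr[a la ->] ->]; exists a.
have [|a la /esym/inL aL] := memA (linfun (@fst _ 'rV[R]_q) @^-1: H1)%VS.
  by apply/fsetUP; left; apply/imfsetP; exists H1.
have [|b lb /esym/inL' bL'] := memA (linfun (@snd 'rV[R]_p _) @^-1: H2)%VS.
  by apply/fsetUP; right; apply/imfsetP; exists H2.
(* Linking puts every plane on the same side as the head of [l], but [a] and [b] come from different
   factors. *)
have hl : head 0 l \in l by case: (l) la => //= c s _; rewrite mem_head.
have [hL|hL'] := LL' _ hl.
  by apply: (nLL' b lb); split=> //; exact: (reach_vanishes LL' nLL' hl hL (cl b lb)).
apply: (nLL' a la); split=> //; apply: (reach_vanishes _ _ hl hL' (cl a la)) => c lc.
  by apply/or_comm; exact: LL'.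
by move=> [? ?]; apply: (nLL' c lc); split.
Qed.

(** * Special vertices as finite tests on integral equations *)

Definition special_quads l a (w : quad) :=
  all (fun b => parallel a b ||
    has (fun c => (qdot c w == 0) &&
      has (fun k : int * int => (k.1 != 0) && (c *~ 2 == b *~ k.1 + a *~ k.2))
        [:: (2, 0); (2, 2); (2, -2); (1, 1); (1, -1)]) l) l.

Definition qpoint (w : quad) : V :=
  qvec w.1.1.1%:~R w.1.1.2%:~R w.1.2%:~R w.2%:~R.

Lemma icov_qpoint a (w : quad) : icov a (qpoint w) = (qdot a w)%:~R :> R.
Proof. by rewrite icov_qvec /qdot !rmorphD !rmorphM. Qed.

Lemma proj_points_lkerI (a b c : covector V) :
  proj_points (lker b) `&` proj_points (lker a) =
    proj_points (lker c) `&` proj_points (lker a) <->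
  forall v, a v = 0 -> (b v = 0 <-> c v = 0).
Proof.
split=> [bc v av|bc]; last first.
  apply/seteqP; split=> p; have [v _ pv] := point_spanned p;
    by move=> [/(proj_points_lker _ pv) + /(proj_points_lker _ pv) av];
       move/(bc _ av) => xv; split; apply/(proj_points_lker _ pv).
have [->|vn0] := eqVneq v 0; first by rewrite !linear0.
have [p pv] := span_point vn0.
have pa : proj_points (lker a) p by apply/(proj_points_lker _ pv).
split=> xv; apply/(proj_points_lker _ pv).
  suff : (proj_points (lker c) `&` proj_points (lker a)) p by case.
  by rewrite -bc; split=> //; apply/(proj_points_lker _ pv).
suff : (proj_points (lker b) `&` proj_points (lker a)) p by case.
by rewrite bc; split=> //; apply/(proj_points_lker _ pv).
Qed.

(** In the test, [2 c = k1 b + k2 a] with [k1 != 0], so [b] and [c] have the same zeros on the plane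
    [a = 0], and [c] passes through the point [w]. The factor 2 admits [c = (b + a) / 2] and
    [c = (b - a) / 2]. *)
Lemma admits_special_vertex_iarr l a (w : quad) :
  0 \notin l -> a \in l -> qdot a w != 0 -> special_quads l a w ->
  admits_special_vertex (iarr l).
Proof.
move=> l0 la aw /allP lw.
have nz b : b \in l -> b != 0 by move=> lb; apply: contraNneq l0 => <-.
have awR : icov a (qpoint w) != 0 by rewrite icov_qpoint intr_eq0.
have wn0 : qpoint w != 0 by apply: contraNneq awR => ->; rewrite linear0.
have [P Pw] := span_point wn0; exists (lker (icov a)), P; split.
- by apply/mem_iarr; exists a.
- by move/(proj_points_lker _ Pw)/eqP; apply/negP.
move=> _ /mem_iarr[b lb ->] ba; have := lw b lb; case/orP.
  by rewrite -(@parallel_lker R) ?nz// eq_sym (negbTE ba).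
case/hasP => c lc /andP[/eqP cw /hasP[[k1 k2] _ /andP[/= k0 /eqP ck]]].
exists (lker (icov c)); split; first by apply/mem_iarr; exists c.
  by apply/(proj_points_lker _ Pw); rewrite icov_qpoint cw.
apply/proj_points_lkerI => v av.
have : icov (c *~ 2 + a *~ 0) v = k1%:~R * icov b v :> R.
  by rewrite mulr0z addr0 ck icov_comb av mulr0 addr0.
rewrite icov_comb av mulr0 addr0 => e; split=> [bv|cv]; move: e.
  by rewrite bv mulr0 => /eqP; rewrite mulf_eq0 intr_eq0 => /eqP.
by rewrite cv mulr0 => /esym/eqP; rewrite mulf_eq0 intr_eq0 (negbTE k0) => /eqP.
Qed.

(** The cross product of three vectors in dimension four: its product with [d] is, up to sign, the
    determinant of [a], [b], [c], [d]. *)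
Definition cross (a b c : quad) : quad :=
  let: (a0, a1, a2, a3) := a in let: (b0, b1, b2, b3) := b in
  let: (c0, c1, c2, c3) := c in
  let det x y z x' y' z' x'' y'' z'' : int :=
    x * (y' * z'' - z' * y'') - y * (x' * z'' - z' * x'') + z * (x' * y'' - y' * x'') in
  (det a1 a2 a3 b1 b2 b3 c1 c2 c3, - det a0 a2 a3 b0 b2 b3 c0 c2 c3,
   det a0 a1 a3 b0 b1 b3 c0 c1 c3, - det a0 a1 a2 b0 b1 b2 c0 c1 c2).

(** The vectors [cross a b d] are killed by [a] and [b], hence by [c]. For basis vectors [d], the
    resulting equations are, up to sign, the entries of [cross a b c]. *)
Lemma cross_eq0 a b c :
  (forall u, qdot a u = 0 -> qdot b u = 0 -> qdot c u = 0) -> cross a b c = 0.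
Proof.
move=> H; have {}H d : qdot c (cross a b d) = 0.
  by apply: H; case: a b d => [[[a0 a1] a2] a3] [[[b0 b1] b2] b3] [[[d0 d1] d2] d3];
    rewrite /qdot /=; ring.
have := H (1, 0, 0, 0); have := H (0, 1, 0, 0); have := H (0, 0, 1, 0).
have := H (0, 0, 0, 1).
case: a b c {H} => [[[a0 a1] a2] a3] [[[b0 b1] b2] b3] [[[c0 c1] c2] c3].
rewrite /qdot /= => e3 e2 e1 e0.
by congr (_, _, _, _); [rewrite -[RHS]oppr0 -e0|rewrite -[RHS]oppr0 -e1
  |rewrite -[RHS]oppr0 -e2|rewrite -[RHS]oppr0 -e3]; ring.
Qed.

(* The 2 x 2 minors of (w, v) are combinations of the three equations, with
   2 x 2 minors of their coefficients as multipliers. *)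
Lemma orthogonal3_proportional (a0 a1 a2 a3 b0 b1 b2 b3 c0 c1 c2 c3 v0 v1 v2 v3 : R) :
  a0 * v0 + a1 * v1 + a2 * v2 + a3 * v3 = 0 ->
  b0 * v0 + b1 * v1 + b2 * v2 + b3 * v3 = 0 ->
  c0 * v0 + c1 * v1 + c2 * v2 + c3 * v3 = 0 ->
  let w0 := (a1 * (b2 * c3 - b3 * c2) - a2 * (b1 * c3 - b3 * c1)
    + a3 * (b1 * c2 - b2 * c1)) in
  let w1 := - (a0 * (b2 * c3 - b3 * c2) - a2 * (b0 * c3 - b3 * c0)
    + a3 * (b0 * c2 - b2 * c0)) in
  let w2 := (a0 * (b1 * c3 - b3 * c1) - a1 * (b0 * c3 - b3 * c0)
    + a3 * (b0 * c1 - b1 * c0)) in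
  let w3 := - (a0 * (b1 * c2 - b2 * c1) - a1 * (b0 * c2 - b2 * c0)
    + a2 * (b0 * c1 - b1 * c0)) in
  [/\ w0 * v1 = w1 * v0, w0 * v2 = w2 * v0, w0 * v3 = w3 * v0,
      w1 * v2 = w2 * v1 & w1 * v3 = w3 * v1 /\ w2 * v3 = w3 * v2].
Proof.
set ea := (X in X = 0 -> _); set eb := (X in _ -> X = 0 -> _).
set ec := (X in _ -> _ -> X = 0 -> _) => ea0 eb0 ec0 w0 w1 w2 w3.
have E (m n p x y : R) : x - y = m * ea + n * eb + p * ec -> x = y.
  by rewrite ea0 eb0 ec0 !mulr0 !addr0 => /subr0_eq.
split; last split.
- by apply: (E (b2 * c3 - b3 * c2) (- (a2 * c3 - a3 * c2)) (a2 * b3 - a3 * b2));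
    rewrite /ea /eb /ec /w0 /w1 /w2 /w3; ring.
- by apply: (E (- (b1 * c3 - b3 * c1)) (a1 * c3 - a3 * c1) (- (a1 * b3 - a3 * b1)));
    rewrite /ea /eb /ec /w0 /w1 /w2 /w3; ring.
- by apply: (E (b1 * c2 - b2 * c1) (- (a1 * c2 - a2 * c1)) (a1 * b2 - a2 * b1));
    rewrite /ea /eb /ec /w0 /w1 /w2 /w3; ring.
- by apply: (E (b0 * c3 - b3 * c0) (- (a0 * c3 - a3 * c0)) (a0 * b3 - a3 * b0));
    rewrite /ea /eb /ec /w0 /w1 /w2 /w3; ring.
- by apply: (E (- (b0 * c2 - b2 * c0)) (a0 * c2 - a2 * c0) (- (a0 * b2 - a2 * b0)));
    rewrite /ea /eb /ec /w0 /w1 /w2 /w3; ring.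
- by apply: (E (b0 * c1 - b1 * c0) (- (a0 * c1 - a1 * c0)) (a0 * b1 - a1 * b0));
    rewrite /ea /eb /ec /w0 /w1 /w2 /w3; ring.
Qed.

(** With [w = cross a b c], the 2 x 2 minors of [w] and [v] vanish, so
    [d(w) * v_i = w_i * d(v) = 0], and some [v_i] is nonzero. *)
Lemma cross_solution (a b c d : quad) v : v != 0 ->
  icov a v = 0 -> icov b v = 0 -> icov c v = 0 -> icov d v = 0 ->
  qdot d (cross a b c) = 0.
Proof.
move=> vn0 e1 e2 e3 e; have [i vi] : exists i, v 0 i != 0.
  apply: contrapT => /forallNP nv; move/eqP: vn0; apply; apply/rowP => i.
  by rewrite mxE; apply/eqP/negPn/negP/nv.
suff : (qdot d (cross a b c))%:~R * v 0 i = 0 :> R.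
  by move/eqP; rewrite mulf_eq0 (negbTE vi) orbF intr_eq0 => /eqP.
move: e1 e2 e3 e {vi}; rewrite !icovE; move: i.
case: a b c d => [[[a0 a1] a2] a3] [[[b0 b1] b2] b3] [[[c0 c1] c2] c3] [[[d0 d1] d2] d3].
rewrite /qdot /= => i e1 e2 e3 e.
have := orthogonal3_proportional e1 e2 e3.
set w0 := (X in let _ := X in _); cbv zeta.
set w1 := (X in [/\ _ = X * _, _, _, _ & _]).
set w2 := (X in [/\ _, _ = X * _, _, _ & _]).
set w3 := (X in [/\ _, _, _ = X * _, _ & _]).
case=> e01 e02 e03 e12 [e13 e23].
set D := (X in X * _).
have DE : D = d0%:~R * w0 + d1%:~R * w1 + d2%:~R * w2 + d3%:~R * w3.
  by rewrite /D /w0 /w1 /w2 /w3; ring.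
have {}DE k w : w0 * v 0 k = w * v 0 (inord 0) -> w1 * v 0 k = w * v 0 (inord 1) ->
    w2 * v 0 k = w * v 0 (inord 2) -> w3 * v 0 k = w * v 0 (inord 3) -> D * v 0 k = 0.
  move=> h0 h1 h2 h3; rewrite DE !mulrDl -!mulrA h0 h1 h2 h3.
  by rewrite -[RHS](mulr0 w) -e; ring.
by move: i; apply: forall_ord4; 
  [apply: (DE _ w0)|apply: (DE _ w1)|apply: (DE _ w2)|apply: (DE _ w3)].
Qed.

(** For [b] not parallel to [a], these are the planes other than [a] that meet [a] in the same line
    as [b]. *)
Definition trace_class l a b := [seq c <- l | ~~ parallel a c && (cross a b c == 0)].

(** Three planes through [P], one from each class, leave [w] as the only candidate for [P]; it is
    rejected once some class has no plane through it. Since [w = 0] lies on every plane, passing the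
    test also guarantees that [c1], [c2], [c3] are independent. *)
Definition refutes l (cls : seq (seq quad)) a b1 b2 b3 :=
  [&& ~~ parallel a b1, ~~ parallel a b2, ~~ parallel a b3 &
  all (fun c1 => all (fun c2 => all (fun c3 =>
    let w := cross c1 c2 c3 in has (all (fun c => qdot c w != 0)) cls)
    (trace_class l a b3)) (trace_class l a b2)) (trace_class l a b1)].

(* B lists four independent members of l; some three of them are independent
   together with a. *)
Definition no_special_quads l (B : quad * quad * quad * quad) :=
  let: (b0, b1, b2, b3) := B in
  all [in l] [:: b0; b1; b2; b3] &&
  all (fun a => let cls := [seq trace_class l a b | b <- l & ~~ parallel a b] in
    [|| refutes l cls a b0 b1 b2, refutes l cls a b0 b1 b3, 
        refutes l cls a b0 b2 b3 | refutes l cls a b1 b2 b3]) l.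

Lemma not_admits_special_vertex_iarr l B :
  0 \notin l -> no_special_quads l B -> ~ admits_special_vertex (iarr l).
Proof.
move=> l0; case: B => [[[b0 b1] b2] b3] /andP[/= /and5P[lb0 lb1 lb2 lb3 _] /allP lB].
have nz b : b \in l -> b != 0 by move=> lb; apply: contraNneq l0 => <-.
case=> _ [P [/mem_iarr[a la ->] aP sp]].
have [v vn0 Pv] := point_spanned P.
have av : icov a v != 0 by apply: contra_notN aP => /eqP h; apply/(proj_points_lker _ Pv).
have cls b : b \in l -> ~~ parallel a b ->
    exists2 c, c \in trace_class l a b & icov c v = 0.
  move=> lb ab; have [||_ [/mem_iarr[c lc ->] cP bc]] := sp (lker (icov b)).
  - by apply/mem_iarr; exists b.
  - by apply: contra ab => /eqP ab; rewrite -(@parallel_lker R) ?nz// ab.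
  have cv : icov c v = 0 by apply/(proj_points_lker _ Pv).
  exists c => //; rewrite mem_filter lc andbT; apply/andP; split.
    (* The plane [c] passes through [P] whereas [a] does not, so they differ. *)
    apply: contra av; rewrite -(@parallel_lker R) ?nz// => /eqP ac.
    by rewrite -memv_ker ac memv_ker cv.
  apply/eqP; apply: cross_eq0 => u au bu; apply/eqP; rewrite -(intr_eq0 R) -icov_qpoint.
  apply/eqP; move/proj_points_lkerI: bc => /(_ (qpoint u)) [].
    by rewrite icov_qpoint au.
  by move=> + _; apply; rewrite icov_qpoint bu.
have refuted x y z : x \in l -> y \in l -> z \in l ->
    ~ refutes l [seq trace_class l a b | b <- l & ~~ parallel a b] a x y z.
  move=> lx ly lz /and4P[ax ay az /allP H].
  have [c1 /H/allP{}H c1v] := cls x lx ax.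
  have [c2 /H/allP{}H c2v] := cls y ly ay.
  have [c3 /H/hasP[_ /mapP[b + ->] bH] c3v] := cls z lz az.
  rewrite mem_filter => /andP[ab lb].
  have [c /(allP bH)/negP + cv] := cls b lb ab; apply.
  by apply/eqP; exact: cross_solution c1v c2v c3v cv.
by case/or4P: (lB a la); exact: refuted.
Qed.

End IntegralArrangements.

Definition D4_quads : seq quad :=
  [:: (1, -1, 0, 0); (1, 1, 0, 0); (1, 0, -1, 0); (1, 0, 1, 0);
      (1, 0, 0, -1); (1, 0, 0, 1); (0, 1, -1, 0); (0, 1, 1, 0);
      (0, 1, 0, -1); (0, 1, 0, 1); (0, 0, 1, -1); (0, 0, 1, 1)].

Definition A4_quads : seq quad := basis_quads ++
  [:: (-1, 1, 0, 0); (-1, 0, 1, 0); (-1, 0, 0, 1);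
      (0, 1, -1, 0); (0, 1, 0, -1); (0, 0, 1, -1)].

Definition B4_quads : seq quad := basis_quads ++ D4_quads.

Definition sign_quads : seq quad :=
  [:: (1, 1, 1, 1); (1, 1, 1, -1); (1, 1, -1, 1); (1, 1, -1, -1);
      (1, -1, 1, 1); (1, -1, 1, -1); (1, -1, -1, 1); (1, -1, -1, -1)].

Definition F4_quads : seq quad := B4_quads ++ sign_quads.

(** * Chambers between D4 and B4 *)

Section ChamberSigns.
Context (R : realType).
Local Notation V := 'rV[R]_4.
Local Notation icov := (@int_covector R).
Implicit Types (v w : V) (l : seq quad).

Lemma sort_coordinates v : exists2 s : 'I_4 -> 'I_4, injective s &
  forall i j : 'I_4, (i <= j)%N -> `|v 0 (s j)| <= `|v 0 (s i)|.
Proof.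
pose r : rel 'I_4 := fun i j => `|v 0 j| <= `|v 0 i|.
have r_trans : transitive r by move=> j i k ij jk; exact: le_trans jk ij.
have r_total : total r by move=> i j; exact: le_total.
have r_refl : reflexive r by move=> i; exact: lexx.
pose t := sort r (enum 'I_4).
have st : size t = 4%N by rewrite size_sort size_enum_ord.
exists (fun i => nth ord0 t i) => [i j /eqP|i j ij].
  by rewrite nth_uniq ?st// ?sort_uniq ?enum_uniq// => /eqP/val_inj.
by apply: (sorted_leq_nth r_trans r_refl ord0 (sort_sorted r_total _));
  rewrite ?inE -?/t ?st.
Qed.

Lemma arrangement_complement_iarr l p v : point_line p = <[v]>%VS ->
  arrangement_complement (iarr R l) p <-> forall c, c \in l -> icov c v != 0.
Proof.
move=> pv; split=> [np c lc|nv [_ /mem_iarr[c lc ->]]].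
  apply/eqP => cv; apply: np; exists (lker (icov c)); first by apply/mem_iarr; exists c.
  exact/(proj_points_lker _ pv).
by move/(proj_points_lker _ pv)/eqP; apply/negP; exact: nv.
Qed.

Local Notation i0 := (inord 0 : 'I_4).
Local Notation i1 := (inord 1 : 'I_4).
Local Notation i2 := (inord 2 : 'I_4).
Local Notation i3 := (inord 3 : 'I_4).

(** The hypotheses say [x i0 > x i1 > x i2 > |x i3|], so the squares are strictly decreasing. *)
Lemma dominance_chain (x : 'I_4 -> R) :
  0 < x i0 - x i1 -> 0 < x i1 - x i2 -> 0 < x i2 - x i3 -> 0 < x i2 + x i3 ->
  [/\ 0 < x i0, 0 < x i1, 0 < x i2 & forall i j, i != j -> x i ^+ 2 != x j ^+ 2].
Proof.
have sqr_neq y z : 0 < y - z -> 0 < y + z -> y ^+ 2 <> z ^+ 2 :> R.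
  move=> yz yz' e; have := mulr_gt0 yz yz'.
  by rewrite -subr_sqr e subrr ltxx.
move=> x01 x12 x23 x23'; split; [lra..|].
apply: forall_ord4; apply: forall_ord4; rewrite ?eqxx// => _; apply/eqP;
  first [by apply: sqr_neq; lra|by apply/nesym/sqr_neq; lra].
Qed.

Lemma chain_eq0 (x : 'I_4 -> R) :
  x i0 - x i1 = 0 -> x i1 - x i2 = 0 -> x i2 - x i3 = 0 ->
  x i3 = 0 \/ x i2 + x i3 = 0 -> forall i, x i = 0.
Proof. by move=> x01 x12 x23 x3; apply: forall_ord4; case: x3; lra. Qed.

(* If u_0 > u_1 > u_2 > |u_3| are the coordinates up to order and signs, the
   walls of the chamber are u_0 = u_1, u_1 = u_2, u_2 = u_3 and either u_3 = 0,
   when that plane belongs to the arrangement, or u_2 = - u_3. *)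
Lemma simplicial_iarr l (J : pred 'I_4) : 0 \notin l -> spanning l ->
  (forall v, (forall c, c \in l -> icov c v != 0) <->
     (forall i j, i != j -> v 0 i ^+ 2 != v 0 j ^+ 2) /\
     (forall i, J i -> v 0 i != 0)) ->
  simplicial (iarr R l).
Proof.
move=> l0 sl lP; split; first exact: essential_iarr.
move=> _ [p Ap ->]; have [v _ pv] := point_spanned p.
have [v2 vJ] := (lP v).1 ((arrangement_complement_iarr l pv).1 Ap).
have [s s_inj vs] := sort_coordinates v.
have [s' sK s'K] : bijective s by exact: injF_bij.
(* These signs make [u k v] the absolute value of the k-th coordinate of [v] in decreasing order. *)
pose e k : R := if v 0 (s k) < 0 then -1 else 1.
pose u k : covector V := e k *: coordinate R (s k).
have uE k w : u k w = e k * w 0 (s k) :> R by rewrite /u scale_lfunE lfunE.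
have u2 k w : (u k w : R) ^+ 2 = w 0 (s k) ^+ 2.
  by rewrite uE exprMn /e; case: ifP; rewrite ?sqrrN expr1n mul1r.
have uv k : u k v = `|v 0 (s k)| :> R.
  by rewrite uE /e; case: ltrP => [/ltr0_norm->|/ger0_norm->];
    rewrite ?mulN1r ?mul1r.
pose f (i : 'I_4) : covector V :=
  nth 0 [:: u i0 - u i1; u i1 - u i2; u i2 - u i3;
            if J (s i3) then u i3 else u i2 + u i3] i.
have fE w : [/\ f i0 w = (u i0 w : R) - u i1 w, f i1 w = (u i1 w : R) - u i2 w,
    f i2 w = (u i2 w : R) - u i3 w &
    f i3 w = if J (s i3) then (u i3 w : R) else (u i2 w : R) + u i3 w].
  rewrite /f !inordK//= !add_lfunE !opp_lfunE; split=> //.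
  by case: ifP; rewrite ?add_lfunE.
have f_inj w : (forall i, f i w = 0) -> w = 0.
  move=> fw; have [f0 f1 f2 f3] := fE w; move: f0 f1 f2 f3; rewrite !fw.
  move=> /esym f0 /esym f1 /esym f2 f3; apply/rowP => i; rewrite mxE.
  have := @chain_eq0 (fun k => u k w) f0 f1 f2 _ (s' i).
  move=> /(_ _)/eqP; rewrite -sqrf_eq0 u2 s'K sqrf_eq0 => H; apply/eqP/H.
  by move: f3; case: ifP => _ /esym; [left|right].
have Kp : simplex_cone f p.
  exists v => //; have [f0 f1 f2 f3] := fE v.
  have lt_u (i j : 'I_4) : (i < j)%N -> (u j v : R) < u i v.
    move=> ij; rewrite !uv lt_neqAle vs ?(ltnW ij)// andbT.
    have ij' : s i != s j by rewrite (inj_eq s_inj) -val_eqE ltn_eqF.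
    apply: contra_neq (v2 _ _ ij') => h.
    by rewrite -(real_normK (num_real (v 0 (s i)))) -h real_normK ?num_real.
  apply: forall_ord4; rewrite (f0, f1, f2, f3) ?subr_gt0;
    try by apply: lt_u; rewrite !inordK.
  case: ifP => [/vJ h|_]; first by rewrite uv normr_gt0.
  rewrite ltr_wpDr//; first by rewrite uv.
  by apply: le_lt_trans (lt_u i2 i3 _); rewrite ?uv// !inordK.
rewrite (@connected_component_simplex_cone _ f).
- exact: tetrahedron_simplex_cone.
- move=> q [w qw fw]; apply/(arrangement_complement_iarr _ qw)/lP.
  have [f0 f1 f2 f3] := fE w; have := fw i3; have := fw i2.
  have := fw i1; have := fw i0; rewrite f0 f1 f2 f3 => g0 g1 g2 g3.
  (* If the last wall is [u i3], then [u i2 > u i3 > 0] still gives a positive sum. *)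
  have g3' : 0 < (u i2 w : R) + u i3 w.
    move: g2 g3; clear; case: ifP => // _; set x : R := u i2 w.
    by set y : R := u i3 w; lra.
  have [x0 x1 x2 neq] := @dominance_chain (fun k => u k w) g0 g1 g2 g3'.
  split=> [i j ij|i Ji].
    by rewrite -[i]s'K -[j]s'K -!u2 neq// (can_eq s'K).
  (* The first three forms are positive by dominance; if the last one is concerned, [J] makes it a
     wall. *)
  suff : 0 < (u (s' i) w : R).
    by rewrite uE s'K; apply: contraTneq => ->; rewrite mulr0 ltxx.
  move: Ji; rewrite -[in J i](s'K i); move: (s' i); apply: forall_ord4 => // Jk.
  by move: g3; rewrite Jk.
- move=> q w Aq qw i.
  have [w2 wJ] := (lP w).1 ((arrangement_complement_iarr l qw).1 Aq).
  have U j k : j != k -> (u j w : R) ^+ 2 <> (u k w : R) ^+ 2.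
    by move=> jk; rewrite !u2; apply/eqP/w2; rewrite (inj_eq s_inj).
  have ord_neq (m n : nat) : (m < 4)%N -> (n < 4)%N -> m != n ->
      (inord m : 'I_4) != inord n.
    by move=> m4 n4; rewrite -val_eqE /= !inordK.
  have [f0 f1 f2 f3] := fE w; move: i.
  apply: forall_ord4; rewrite (f0, f1, f2, f3).
  - by move/subr0_eq => h; apply: (@U i0 i1); [exact: ord_neq|rewrite h].
  - by move/subr0_eq => h; apply: (@U i1 i2); [exact: ord_neq|rewrite h].
  - by move/subr0_eq => h; apply: (@U i2 i3); [exact: ord_neq|rewrite h].
  case: ifP => [/wJ w3n0 u30|_ /eqP].
    by move/eqP: (u2 i3 w); rewrite u30 expr0n eq_sym sqrf_eq0 (negbTE w3n0).
  rewrite addr_eq0 => /eqP h; apply: (@U i2 i3); first exact: ord_neq.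
  by rewrite h sqrrN.
- exact: Kp.
Qed.

End ChamberSigns.

(** * The Coxeter arrangements and the deletion chain *)

Lemma no_special_D4_quads : no_special_quads D4_quads
  ((1, -1, 0, 0), (0, 1, -1, 0), (0, 0, 1, -1), (0, 0, 1, 1)).
Proof. by lazy. Qed.

Lemma no_special_F4_quads : no_special_quads F4_quads
  ((1, 0, 0, 0), (0, 1, 0, 0), (0, 0, 1, 0), (0, 0, 0, 1)).
Proof. by lazy. Qed.

Section ChainArrangements.
Context (R : realType).
Local Notation V := 'rV[R]_4.
Local Notation icov := (@int_covector R).
Local Notation iarr := (iarr R).

(** [n] counts the deleted coordinate planes, in the order t, x, y, z, so that [16 - n] planes
    remain. *)
Definition chain_quads n : seq quad := drop n basis_quads ++ D4_quads.

Lemma iarrU l l' : (iarr l `|` iarr l')%fset = iarr (l ++ l').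
Proof.
apply/fsetP => H; rewrite in_fsetU; apply/orP/mem_iarr => [[]/mem_iarr[a la ->]|].
- by exists a; rewrite // mem_cat la.
- by exists a; rewrite // mem_cat la orbT.
case=> a; rewrite mem_cat => /orP[la|la] ->; [left|right];
  by apply/mem_iarr; exists a.
Qed.

Lemma coordinateE i v : coordinate R i v = v 0 i :> R.
Proof. by rewrite lfunE. Qed.

Ltac solve_icov := apply/lfunP => v;
  rewrite icovE /= ?(add_lfunE, opp_lfunE, coordinateE) ?(mulr0z, mulr1z, mulrN1z);
  ring.

Lemma arr_of_quads (l : seq quad) (s : seq (covector V)) :
  [seq icov a | a <- l] = s -> arr s = iarr l.
Proof. by move=> <-. Qed.

Lemma arrA4E : arrA4 R = iarr A4_quads.
Proof. by apply: arr_of_quads; do !congr cons; solve_icov. Qed.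

Lemma arrD4E : arrD4 R = iarr D4_quads.
Proof. by apply: arr_of_quads; do !congr cons; solve_icov. Qed.

Lemma arrB4E : arrB4 R = iarr B4_quads.
Proof.
rewrite /arrB4 arrD4E (@arr_of_quads basis_quads) ?iarrU//.
by do !congr cons; solve_icov.
Qed.

Lemma arrF4E : arrF4 R = iarr F4_quads.
Proof.
by rewrite /arrF4 arrB4E (@arr_of_quads sign_quads) ?iarrU.
Qed.

Lemma chain15E : chain15 R = iarr (chain_quads 1).
Proof.
rewrite /chain15 arrB4E (@arr_of_quads (take 1 basis_quads)) ?iarrD//.
by do !congr cons; solve_icov.
Qed.

Lemma chain14E : chain14 R = iarr (chain_quads 2).
Proof.
rewrite /chain14 arrB4E (@arr_of_quads (take 2 basis_quads)) ?iarrD//.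
by do !congr cons; solve_icov.
Qed.

Lemma chain13E : chain13 R = iarr (chain_quads 3).
Proof.
rewrite /chain13 arrB4E (@arr_of_quads (take 3 basis_quads)) ?iarrD//.
by do !congr cons; solve_icov.
Qed.

Lemma basis_quads_complement n v : (n < 4)%N ->
  (forall c, c \in drop n basis_quads -> icov c v != 0) <->
  (forall i : 'I_4, (n <= i)%N -> v 0 i != 0).
Proof.
have icov_basis (i : 'I_4) : icov (nth 0 basis_quads i) v = v 0 i :> R.
  move: i; apply: forall_ord4;
  by rewrite inordK// icovE /= ?(mulr0z, mulr1z) ?(mul0r, mul1r, addr0, add0r).
move=> n4; split=> [H i ni|H c].
  rewrite -icov_basis; apply: H.
  rewrite -(subnKC ni) -nth_drop mem_nth// size_drop ltn_sub2r//.
case/(nthP 0) => i; rewrite size_drop ltn_subRL nth_drop => i4 <-.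
by rewrite (icov_basis (Ordinal i4)) H//= leq_addr.
Qed.

Lemma D4_quads_complement v :
  (forall c, c \in D4_quads -> icov c v != 0) <->
  (forall i j, i != j -> v 0 i ^+ 2 != v 0 j ^+ 2).
Proof.
have sqr_neq (x y : R) : (x ^+ 2 != y ^+ 2) = (x + y != 0) && (x - y != 0).
  by rewrite -subr_eq0 subr_sqr mulf_eq0 negb_or andbC.
split=> [H|H c].
  have {}H c : c \in D4_quads -> icov c v != 0 :> R by exact: H.
  have := H (1, -1, 0, 0) isT; have := H (1, 1, 0, 0) isT.
  have := H (1, 0, -1, 0) isT; have := H (1, 0, 1, 0) isT.
  have := H (1, 0, 0, -1) isT; have := H (1, 0, 0, 1) isT.
  have := H (0, 1, -1, 0) isT; have := H (0, 1, 1, 0) isT.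
  have := H (0, 1, 0, -1) isT; have := H (0, 1, 0, 1) isT.
  have := H (0, 0, 1, -1) isT; have := H (0, 0, 1, 1) isT.
  rewrite !icovE /= !(mulr0z, mulr1z, mulrN1z) !(mul0r, mul1r, mulN1r, addr0, add0r).
  move=> h1 h2 h3 h4 h5 h6 h7 h8 h9 h10 h11 h12.
  apply: forall_ord4; apply: forall_ord4; rewrite ?eqxx// => _;
    first [by rewrite sqr_neq; apply/andP|by rewrite eq_sym sqr_neq; apply/andP].
have ord_neq (m n : nat) : (m < 4)%N -> (n < 4)%N -> m != n ->
    (inord m : 'I_4) != inord n.
  by move=> m4 n4; rewrite -val_eqE /= !inordK.
have {}H m n : (m < 4)%N -> (n < 4)%N -> m != n ->
    (v 0 (inord m) + v 0 (inord n) != 0) && (v 0 (inord m) - v 0 (inord n) != 0).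
  by move=> m4 n4 mn; rewrite -sqr_neq H// ord_neq.
have /andP[? ?] := H 0%N 1%N isT isT isT; have /andP[? ?] := H 0%N 2%N isT isT isT.
have /andP[? ?] := H 0%N 3%N isT isT isT; have /andP[? ?] := H 1%N 2%N isT isT isT.
have /andP[? ?] := H 1%N 3%N isT isT isT; have /andP[? ?] := H 2%N 3%N isT isT isT.
rewrite !inE; do ![case/orP => [/eqP ->|]]; last move/eqP ->;
  by rewrite icovE /= !(mulr0z, mulr1z, mulrN1z) !(mul0r, mul1r, mulN1r, addr0, add0r).
Qed.

Lemma chain_quads_simplicial n : (n < 4)%N -> simplicial (iarr (chain_quads n)).
Proof.
move=> n4; apply: (@simplicial_iarr _ _ (fun i : 'I_4 => n <= i)%N).
- by case: n n4 => [|[|[|[]]]].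
- by case: n n4 => [|[|[|[]]]] //; lazy.
move=> v; split=> [H|[H1 H2] c].
  split; first by apply/D4_quads_complement => c Dc; apply: H; rewrite mem_cat Dc orbT.
  by apply/(basis_quads_complement _ n4) => c Dc; apply: H; rewrite mem_cat Dc.
rewrite mem_cat => /orP[]; first exact: (basis_quads_complement _ n4).2.
exact: (D4_quads_complement v).2.
Qed.

Lemma chain_quads_irreducible n : (n < 4)%N -> irreducible (iarr (chain_quads n)).
Proof.
by case: n => [|[|[|[]]]] // _; apply: irreducible_iarr => //; lazy.
Qed.

(** One pair serves the whole chain: the plane [y = z] and the point [[0:0:1:0]]. On that plane y
    may be replaced by z, which gives an equation free of y; [y = 0] and [y + z = 0] become [z = 0],
    which is never deleted. *)
Lemma chain_quads_special n : (n < 4)%N -> admits_special_vertex (iarr (chain_quads n)).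
Proof.
by case: n => [|[|[|[]]]] // _;
  apply: (@admits_special_vertex_iarr _ _ (0, 0, 1, -1) (0, 0, 1, 0)) => //; lazy.
Qed.

End ChainArrangements.

Theorem theorem1p1 (R : realType) :
  [/\ [/\ essential (arrA4 R), irreducible (arrA4 R) &
          admits_special_vertex (arrA4 R)],
      [/\ essential (arrB4 R), irreducible (arrB4 R) &
          admits_special_vertex (arrB4 R)],
      [/\ essential (arrD4 R), irreducible (arrD4 R) &
          ~ admits_special_vertex (arrD4 R)] &
      [/\ essential (arrF4 R), irreducible (arrF4 R) &
          ~ admits_special_vertex (arrF4 R)]] /\
  [/\ [/\ (chain13 R `<` chain14 R)%fset, (chain14 R `<` chain15 R)%fset,
          (chain15 R `<` chain16 R)%fset & chain16 R = arrB4 R],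
      [/\ irreducible (chain13 R), simplicial (chain13 R) &
          admits_special_vertex (chain13 R)],
      [/\ irreducible (chain14 R), simplicial (chain14 R) &
          admits_special_vertex (chain14 R)],
      [/\ irreducible (chain15 R), simplicial (chain15 R) &
          admits_special_vertex (chain15 R)] &
      [/\ irreducible (chain16 R), simplicial (chain16 R) &
          admits_special_vertex (chain16 R)]].
Proof.
rewrite /chain16 chain13E chain14E chain15E arrA4E arrD4E arrF4E arrB4E.
rewrite -[B4_quads]/(chain_quads 0).
have proper n : (n < 3)%N ->
    (iarr R (chain_quads n.+1) `<` iarr R (chain_quads n))%fset.
  by case: n => [|[|[]]] // _; apply: iarr_proper => //; apply/allP; lazy.
have chain n : (n < 4)%N -> [/\ irreducible (iarr R (chain_quads n)),
    simplicial (iarr R (chain_quads n)) &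
    admits_special_vertex (iarr R (chain_quads n))].
  move=> n4; split; [exact: chain_quads_irreducible|exact: chain_quads_simplicial|].
  exact: chain_quads_special.
split; split; try exact: chain.
- split; [by apply: essential_iarr => //; lazy|by apply: irreducible_iarr => //; lazy|].
  (* The pair is [t = 0] with [[1:0:0:0]]: on [t = 0] the planes [x = t], [y = t], [z = t] have the
     traces of [x = 0], [y = 0], [z = 0]. *)
  by apply: (@admits_special_vertex_iarr _ _ (1, 0, 0, 0) (1, 0, 0, 0)) => //; lazy.
- have [? [? _] ?] := chain 0%N isT; by split.
- split; [by apply: essential_iarr => //; lazy|by apply: irreducible_iarr => //; lazy|].
  exact: (@not_admits_special_vertex_iarr R _ _ _ no_special_D4_quads).
- split; [by apply: essential_iarr => //; lazy|by apply: irreducible_iarr => //; lazy|].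
  exact: (@not_admits_special_vertex_iarr R _ _ _ no_special_F4_quads).
- by split; try exact: proper.
Qed.
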